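(* Let $A$ be a unital commutative $\mathbb R$-algebra with $X(A)\neq\varnothing$, let $(T_a)_{a\in A}$ be a family of positive real numbers, and let $\mathcal C\subseteq A$ be the unital cone generated by the set $$\left\{(T_a-a)^j(T_a+a)^k : a\in A,\ j,k\in\mathbb N_0\right\}.$$ Let $$K=\{\alpha\in X(A):|\alpha(a)|\le T_a\text{ for all }a\in A\}.$$ If $c\in A$ satisfies $\alpha(c)>0$ for every $\alpha\in K$, then $c\in\mathcal C$.
   Context: $\mathbb N_0=\{0,1,2,\dots\}$. For a unital commutative $\mathbb R$-algebra $A$, $X(A)$ denotes the set of all (unital) $\mathbb R$-algebra homomorphisms $A\to\mathbb R$. A cone is a subset $C\subseteq A$ such that $C+C\subseteq C$ and $\lambda\cdot C\subseteq C$ for all real $\lambda\ge 0$; it is unital if $1\in C$. The unital cone generated by a set is the smallest unital cone containing it. A real number $t$ is identified with $t\cdot 1\in A$, and $x^0=1$ for $x\in A$. *)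

(* Defs.v *)
From HB Require Import structures.
From mathcomp Require Import all_boot all_order all_algebra.
From mathcomp Require Import classical_sets reals.

Set Implicit Arguments.
Unset Strict Implicit.
Unset Printing Implicit Defensive.

Import Order.TTheory GRing.Theory Num.Theory.
Local Open Scope classical_set_scope.
Local Open Scope ring_scope.

(* Characters of A: unital, multiplicative and R-linear maps into the scalars.
   Commutative algebras of type comAlgType are nontrivial (1 != 0); this loses
   nothing for algebras that have a character. *)
Definition character (R : realType) (A : comAlgType R) : Type :=
  {lrmorphism A -> R | *%R}.

Definition character_space (R : realType) (A : comAlgType R) :
  set (character A) := [set: character A].
Arguments character_space {R} A.

Definition is_cone (R : realType) (A : comAlgType R) (C : set A) : Prop :=
  (forall x y : A, C x -> C y -> C (x + y)) /\
  (forall (l : R) (x : A), 0 <= l -> C x -> C (l *: x)).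

Definition is_unital_cone (R : realType) (A : comAlgType R) (C : set A) : Prop :=
  is_cone C /\ C 1.

Definition unital_cone_gen (R : realType) (A : comAlgType R) (G : set A) :
  set A := smallest (@is_unital_cone R A) G.

(* The real number T a is viewed in A as (T a)%:A = T a *: 1. *)
Definition box_products (R : realType) (A : comAlgType R) (T : A -> R) : set A :=
  [set x : A | exists (a : A) (j k : nat),
     x = ((T a)%:A - a) ^+ j * ((T a)%:A + a) ^+ k].

Definition bounded_characters (R : realType) (A : comAlgType R) (T : A -> R) :
  set (character A) :=
  [set alpha : character A | forall a : A, `|alpha a| <= T a].

(* Main.v *)
(* Let C be the cone and Cl its closure { x | x + e in C for all e > 0 }.  For a
   single a, the products of powers of T_a - a and T_a + a span a cone in C
   that is closed under multiplication.  Inside it, Bernstein's approximation of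
   the square function shows that b^2 is in Cl for every b, and the Newton-like
   iteration q <- q + (y - q^2)/2 approximates an affine function y of a by
   squares.  An AM-GM estimate then gives b^2 (T_a - a), b^2 (T_a + a) in Cl, so
   { x | b^2 x in Cl for all b } is an archimedean quadratic module.  If it
   contains no c - e with e > 0, then adjoining -c to it leaves it proper; a
   maximal proper quadratic module containing the result is total, hence (being
   archimedean) is the nonnegativity set of a character alpha, which lies in K
   and satisfies alpha(c) <= 0. *)
Require Import Defs.
From HB Require Import structures.
From mathcomp Require Import all_boot all_order all_algebra.
From mathcomp Require Import boolp classical_sets reals.
From mathcomp Require Import ring lra.

Set Implicit Arguments.
Unset Strict Implicit.
Unset Printing Implicit Defensive.

Import Order.TTheory GRing.Theory Num.Theory.
Local Open Scope classical_set_scope.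
Local Open Scope ring_scope.

(* Convertible to [k%:A], but recognised by [ring] as a ring morphism. *)
Local Notation "k %:K" := (GRing.in_alg _ k) (at level 2, format "k %:K").

(** * Arithmetic in unital cones *)

Section UnitalCones.
Variables (R : realType) (A : comAlgType R).
Implicit Types (C D : set A) (x y : A) (k t e : R).

Lemma natK (n : nat) : n%:R%:K = n%:R :> A.
Proof. exact: rmorph_nat. Qed.

Lemma unital_cone_gen_unital (G : set A) : is_unital_cone (unital_cone_gen G).
Proof.
split; [split=> [x y Gx Gy|l x l_ge0 Gx]|] => M [Mc GM].
- by apply: Mc.1.1; [apply: Gx | apply: Gy].
- by apply: Mc.1.2 => //; apply: Gx.
- exact: Mc.2.
Qed.

Section OneCone.
Variables (C : set A) (C_cone : is_unital_cone C).

Lemma coneD x y : C x -> C y -> C (x + y).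
Proof. exact: C_cone.1.1. Qed.

Lemma coneZ k x : 0 <= k -> C x -> C (k%:K * x).
Proof. by move=> k0 Cx; rewrite mulr_algl; apply: C_cone.1.2. Qed.

Lemma coneK k : 0 <= k -> C k%:K.
Proof. by move=> k0; apply: C_cone.1.2 => //; apply: C_cone.2. Qed.

Lemma cone_unscale k x : 0 < k -> C (k%:K * x) -> C x.
Proof.
move=> k0 Ckx; rewrite -[x]scale1r -(mulVf (lt0r_neq0 k0)) -scalerA.
by rewrite -[k *: x]mulr_algl; apply: C_cone.1.2 => //; rewrite invr_ge0 ltW.
Qed.

Lemma coneMn (n : nat) x : C x -> C (n%:R * x).
Proof. by move=> Cx; rewrite -natK; apply: coneZ. Qed.

Lemma cone_unscalen (n : nat) x : C (n.+1%:R * x) -> C x.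
Proof. by rewrite -natK; apply: cone_unscale; rewrite ltr0Sn. Qed.

Lemma cone_nat (n : nat) : C n%:R.
Proof. by rewrite -natK; apply: coneK. Qed.

End OneCone.

(** * Squares and square roots in cones closed under multiplication *)

Definition closed_under_mul D := forall x y, D x -> D y -> D (x * y).

(** This is the mean of [(s + X)^2], where [X] is a sum of [n] independent steps [t] or [-t] with
    weights [(t + b) / 2t] and [(t - b) / 2t]. The induction conditions on one step. *)
Lemma shifted_sq_mem D t b : is_unital_cone D -> closed_under_mul D -> 0 < t ->
  D (t%:K - b) -> D (t%:K + b) ->
  forall (n : nat) (s : R),
    D ((s%:K + n%:R * b) ^+ 2 + n%:R * (t%:K ^+ 2 - b ^+ 2)).
Proof.
move=> Dc DM t0 Dm Dp; elim=> [|n IHn] s.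
  have -> : (s%:K + 0%:R * b) ^+ 2 + 0%:R * (t%:K ^+ 2 - b ^+ 2)
           = (s ^+ 2)%:K by ring.
  by apply: coneK => //; apply: sqr_ge0.
have t20 : 0 < 2 * t by lra.
apply: (cone_unscale Dc t20).
have -> : (2 * t)%:K *
    ((s%:K + n.+1%:R * b) ^+ 2 + n.+1%:R * (t%:K ^+ 2 - b ^+ 2)) =
    (t%:K + b) * (((s + t)%:K + n%:R * b) ^+ 2 + n%:R * (t%:K ^+ 2 - b ^+ 2)) +
    (t%:K - b) * (((s - t)%:K + n%:R * b) ^+ 2 + n%:R * (t%:K ^+ 2 - b ^+ 2)).
  by ring.
by apply: coneD => //; apply: DM.
Qed.

Lemma natr_gt (x e : R) : 0 < e -> exists n : nat, x < n.+1%:R * e.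
Proof.
move=> e0; exists (Num.bound `|x / e|); rewrite -ltr_pdivrMr //.
apply: (le_lt_trans (ler_norm _)); apply: (lt_trans (archi_boundP _)) => //.
by rewrite ltr_nat.
Qed.

Lemma sq_add_pos_mem D t b e : is_unital_cone D -> closed_under_mul D ->
  0 < t -> D (t%:K - b) -> D (t%:K + b) -> 0 < e -> D (b ^+ 2 + e%:K).
Proof.
move=> Dc DM t0 Dm Dp e0; have [n t2] := natr_gt (t ^+ 2) e0.
(* At [s = 0], dividing by [(n + 2)(n + 1)] leaves [b^2 + t^2 / (n + 1)], whose last term is below
   [e] by the choice of [n]. *)
have Dn := shifted_sq_mem Dc DM t0 Dm Dp n.+2 0.
apply: (cone_unscalen Dc (n := n)); apply: (cone_unscalen Dc (n := n.+1)).
have -> : n.+2%:R * (n.+1%:R * (b ^+ 2 + e%:K)) =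
    ((0 : R)%:K + n.+2%:R * b) ^+ 2 + n.+2%:R * (t%:K ^+ 2 - b ^+ 2)
    + n.+2%:R * (n.+1%:R * e - t ^+ 2)%:K.
  by ring.
by apply: coneD => //; apply: coneMn => //; apply: coneK => //; lra.
Qed.

(* One step of the iteration q <- q + (y - q^2) / 2 for the square root of y,
   with 4r the residue y - q^2.  The residues decrease and q is half of their
   sum, so that q <= 1 forces 2nr <= 1. *)
Lemma sqrt_iteration D y : is_unital_cone D -> closed_under_mul D ->
  D y -> D (1 - y) -> forall n : nat, exists q r : A,
  [/\ y = q ^+ 2 + 4 * r, D q, D (1 - q), D r & D (q - 2 * n%:R * r)].
Proof.
move=> Dc DM Dy D1y; elim=> [|n [q [r [yE Dq D1q Dr Dqr]]]].
  exists 0, ((4^-1)%:K * y); split.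
  - have : (4 * 4^-1)%:K * y = y :> A.
      by rewrite mulfV ?pnatr_eq0 // rmorph1 mul1r.
    by move=> {1}<-; ring.
  - exact: (cone_nat Dc 0).
  - by rewrite subr0; apply: (cone_nat Dc 1).
  - by apply: coneZ => //; rewrite invr_ge0.
  - by rewrite mulr0 mul0r subr0; apply: (cone_nat Dc 0).
(* The new residue [y - (q + 2r)^2] is [4r(1 - q - r)], so this factor has to lie in [D]. *)
have D1qr : D (1 - q - r).
  apply: (cone_unscalen Dc (n := 3)).
  have -> : 4 * (1 - q - r) = (1 - q) * (2 + (1 - q)) + (1 - y).
    by rewrite yE; ring.
  apply: coneD => //; apply: DM => //.
  by apply: coneD => //; apply: (cone_nat Dc 2).
exists (q + 2 * r), (r * (1 - q - r)); split.
- by rewrite yE; ring.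
- by apply: coneD => //; apply: coneMn.
- apply: (cone_unscalen Dc (n := 1)).
  have -> : 2 * (1 - (q + 2 * r)) = (1 - q) * (1 - q) + (1 - y).
    by rewrite yE; ring.
  by apply: coneD => //; apply: DM.
- exact: DM.
- have -> : q + 2 * r - 2 * n.+1%:R * (r * (1 - q - r)) =
     q - 2 * n%:R * r + 2 * (n.+1%:R * (r * (q + r))) by ring.
  apply: coneD => //; do 2!apply: coneMn => //; apply: DM => //; exact: coneD.
Qed.

(** After [N] iterations [2Nr <= q <= 1] in the order of [D], so the residue [4r] is at most
    [2 / N]. *)
Lemma approx_sqrt D y e : is_unital_cone D -> closed_under_mul D ->
  D y -> D (1 - y) -> 0 < e -> exists q r : A,
  [/\ y = q ^+ 2 + r, D r & D (e%:K - r)].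
Proof.
move=> Dc DM Dy D1y e0; have [n hn] := natr_gt 2 e0.
have [q [r [yE Dq D1q Dr Dqr]]] := sqrt_iteration Dc DM Dy D1y n.+1.
exists q, (4 * r); split=> //; first exact: coneMn.
apply: (cone_unscalen Dc (n := n)); apply: (cone_unscalen Dc (n := 1)).
have -> : 2 * (n.+1%:R * (e%:K - 4 * r)) =
  2 * (n.+1%:R * e - 2)%:K + 4 * ((1 - q) + (q - 2 * n.+1%:R * r)) by ring.
apply: coneD => //; apply: coneMn => //; last exact: coneD.
by apply: coneK => //; lra.
Qed.

(** * Closure of a cone in the direction of the unit *)

Definition cone_closure C : set A := [set x | forall e, 0 < e -> C (x + e%:K)].

Lemma sub_cone_closure C : is_unital_cone C -> C `<=` cone_closure C.
Proof.
by move=> Cc x Cx e e0; apply: coneD => //; apply: coneK => //; apply: ltW.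
Qed.

Lemma cone_closure_unital C :
  is_unital_cone C -> is_unital_cone (cone_closure C).
Proof.
move=> Cc; split; [split=> [x y Cx Cy|l x]|] => [e e0||].
- have e2 : 0 < e / 2 by lra.
  have -> : x + y + e%:K = (x + (e / 2)%:K) + (y + (e / 2)%:K).
    by rewrite [in LHS](splitr e); ring.
  by apply: coneD => //; [apply: Cx | apply: Cy].
- rewrite le_eqVlt => /predU1P[<- _ e e0|l0 Cx e e0].
    by rewrite scale0r add0r; apply: coneK => //; apply: ltW.
  have -> : l *: x + e%:K = l%:K * (x + (l^-1 * e)%:K).
    by rewrite mulrDr -rmorphM mulVKf ?gt_eqF // mulr_algl.
  by apply: coneZ (ltW l0) _ => //; apply: Cx; rewrite mulr_gt0 ?invr_gt0.
- by apply: sub_cone_closure => //; apply: Cc.2.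
Qed.

Lemma cone_closure_idem C x : is_unital_cone C ->
  (forall e, 0 < e -> cone_closure C (x + e%:K)) -> cone_closure C x.
Proof.
move=> Cc Cx e e0; have e2 : 0 < e / 2 by lra.
rewrite [e]splitr rmorphD addrA; exact: Cx.
Qed.

End UnitalCones.

(** * Archimedean quadratic modules and their maximal proper extensions *)

Section QuadraticModules.
Variables (R : realType) (A : comAlgType R).
Implicit Types (Q C D : set A) (x y : A) (k t e : R).

Definition qmodule Q :=
  is_unital_cone Q /\ (forall b x, Q x -> Q (b ^+ 2 * x)).

Definition archimedean Q := forall x, exists k : R, Q (k%:K - x).

Definition proper Q := ~ Q (- 1).

(** Multipliers replace the sums of squares usual in adjoining an element: for a quadratic module
    they contain the squares and are closed under sums and products, without any finite sums to
    handle. *)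
Definition multiplier Q : set A := [set s | forall x, Q x -> Q (s * x)].

Definition qmodule_adjoin Q x : set A :=
  [set z | exists q s, [/\ Q q, multiplier Q s & z = q + s * x]].

Lemma archimedean_ge Q x : is_unital_cone Q -> archimedean Q ->
  exists k0 : R, forall k : R, k0 <= k -> Q (k%:K - x).
Proof.
move=> Qc Qa; have [k0 Qk0] := Qa x; exists k0 => k lek.
have -> : k%:K - x = (k0%:K - x) + (k - k0)%:K by ring.
by apply: coneD => //; apply: coneK => //; rewrite subr_ge0.
Qed.

Lemma sub_archimedean Q Q' : Q `<=` Q' -> archimedean Q -> archimedean Q'.
Proof. by move=> QQ' Qa x; have [k /QQ'] := Qa x; exists k. Qed.

Section OneQModule.
Variables (Q : set A) (Qm : qmodule Q).
Let Qc : is_unital_cone Q := Qm.1.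

Lemma multiplier_sq b : multiplier Q (b ^+ 2).
Proof. by move=> x; apply: Qm.2. Qed.

Lemma multiplierD s s' :
  multiplier Q s -> multiplier Q s' -> multiplier Q (s + s').
Proof.
by move=> Qs Qs' x Qx; rewrite mulrDl; apply: coneD; [|apply: Qs|apply: Qs'].
Qed.

Lemma multiplierM s s' :
  multiplier Q s -> multiplier Q s' -> multiplier Q (s * s').
Proof. by move=> Qs Qs' x Qx; rewrite -mulrA; apply/Qs/Qs'. Qed.

Lemma multiplierK k : 0 <= k -> multiplier Q k%:K.
Proof. by move=> k0 x; apply: coneZ. Qed.

Lemma multiplier_mem s : multiplier Q s -> Q s.
Proof. by move=> Qs; rewrite -[s]mulr1; apply/Qs/Qc.2. Qed.

Lemma qmodule_adjoin_qmodule x : qmodule (qmodule_adjoin Q x).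
Proof.
split; [split; [split|]|].
- move=> _ _ [q [s [Qq Qs ->]]] [q' [s' [Qq' Qs' ->]]].
  exists (q + q'), (s + s'); split; [exact: coneD|exact: multiplierD|ring].
- move=> l _ l0 [q [s [Qq Qs ->]]]; exists (l%:K * q), (l%:K * s); split.
  + exact: coneZ.
  + by apply: multiplierM => //; apply: multiplierK.
  + by rewrite -mulr_algl -[_%:A]/(l%:K); ring.
- exists 1, 0; split; [exact: Qc.2| |ring].
  by have := multiplierK (lexx 0); rewrite rmorph0.
- move=> b _ [q [s [Qq Qs ->]]]; exists (b ^+ 2 * q), (b ^+ 2 * s); split.
  + exact: Qm.2.
  + by apply: multiplierM => //; apply: multiplier_sq.
  + ring.
Qed.

Lemma sub_qmodule_adjoin x : Q `<=` qmodule_adjoin Q x.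
Proof.
move=> q Qq; exists q, 0; split => //; last by ring.
by have := multiplierK (lexx 0); rewrite rmorph0.
Qed.

Lemma mem_qmodule_adjoin x : qmodule_adjoin Q x x.
Proof.
exists 0, 1; split; [exact: (cone_nat Qc 0)| |ring].
by have := multiplierK ler01; rewrite rmorph1.
Qed.

(** For large [k], every term on the right of [k^2 (c + r) - 1 = (k - s)^2 (c + r) + 2k (sc - 1) + r
    s (2k - s) + (2k - s^2 c - 1)] is in [Q]. Dividing by [k^2] lowers [r] by [k^-2], an amount
    independent of [r]. *)
Lemma adjoin_opp_step s c : archimedean Q -> multiplier Q s -> Q (s * c - 1) ->
  exists2 k : R, 0 < k &
    forall r : R, 0 <= r -> Q (c + r%:K) -> Q (c + (r - k)%:K).
Proof.
move=> Qa Qs Qsc.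
have [k1 Qk1] := archimedean_ge s Qc Qa.
have [k2 Qk2] := archimedean_ge (s ^+ 2 * c + 1) Qc Qa.
pose k := `|k1| + `|k2| + 1.
have k0 : 0 < k by rewrite /k; have := normr_ge0 k1; have := normr_ge0 k2; lra.
have k2k : 0 < k ^+ 2 by rewrite exprn_gt0.
exists (k ^- 2) => [|r r0 Qcr]; first by rewrite invr_gt0.
apply: (cone_unscale Qc k2k).
have -> : (k ^+ 2)%:K * (c + (r - k ^- 2)%:K) =
  (k ^+ 2 * r - k ^+ 2 * k ^- 2)%:K + (k ^+ 2)%:K * c by ring.
rewrite mulfV ?gt_eqF //.
have -> : (k ^+ 2 * r - 1)%:K + (k ^+ 2)%:K * c =
  (k%:K - s) ^+ 2 * (c + r%:K) + (2 * k)%:K * (s * c - 1)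
  + (r%:K * (s * ((2 * k)%:K - s)) + ((2 * k)%:K - (s ^+ 2 * c + 1))) by ring.
have le_k1 : k1 <= 2 * k.
  rewrite /k; have := ler_norm k1; have := normr_ge0 k1.
  by have := normr_ge0 k2; lra.
have le_k2 : k2 <= 2 * k.
  rewrite /k; have := ler_norm k2; have := normr_ge0 k2.
  by have := normr_ge0 k1; lra.
apply: coneD => //; apply: coneD => //.
- exact: Qm.2.
- by apply: coneZ => //; lra.
- by apply: coneZ => //; apply/Qs/Qk1.
- exact: Qk2.
Qed.

(** If [-1 = q - s c], then [s c - 1] is in [Q]. Starting from an archimedean bound for [-c], steps
    of fixed size lower [r] in [c + r] until it is negative, against the hypothesis on [c]. *)
Lemma proper_adjoin_opp c : archimedean Q ->
  (forall e, 0 < e -> ~ Q (c - e%:K)) -> proper (qmodule_adjoin Q (- c)).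
Proof.
move=> Qa Qce [q [s [Qq Qs qsE]]].
have qE : q = s * c - 1 by rewrite qsE; ring.
rewrite qE in Qq; have [k k0 step] := adjoin_opp_step Qa Qs Qq.
have below n : forall r : R, 0 <= r -> r < n%:R * k -> ~ Q (c + r%:K).
  elim: n => [|n IHn] r r0 rn Qcr; first by move: rn; rewrite mul0r ltNge r0.
  have Qcrk := step r r0 Qcr.
  have [rk|rk] := ltP r k.
    apply: (Qce (k - r)); first lra.
    by have -> : c - (k - r)%:K = c + (r - k)%:K by ring.
  apply: (IHn (r - k)) => //; first by lra.
  by move: rn; rewrite -natr1 mulrDl mul1r; lra.
have [r Qr] := Qa (- c); have [n rn] := natr_gt `|r| k0.
apply: (below n.+1 `|r| (normr_ge0 r) rn).
have -> : c + `|r|%:K = (r%:K - - c) + (`|r| - r)%:K by ring.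
by apply: coneD => //; apply: coneK => //; rewrite subr_ge0 ler_norm.
Qed.

Lemma exists_maximal_qmodule : proper Q -> exists Q' : set A,
  [/\ Q `<=` Q', qmodule Q', proper Q' &
      forall Q'', Q' `<=` Q'' -> qmodule Q'' -> proper Q'' -> Q'' `<=` Q'].
Proof.
(* Zorn's lemma also asks for an upper bound of the empty chain, hence the union
   with [Q]. *)
move=> Qp; pose P X := qmodule (Q `|` X) /\ proper (Q `|` X).
have [F FP Ftot|X [[Xm Xp] Xmax]] := @Zorn_bigcup A P.
  pose U := Q `|` \bigcup_(X in F) X.
  have UE x : U x -> Q x \/ exists2 X, F X & (Q `|` X) x.
    by case=> [|[X FX Xx]]; [left|right; exists X => //; right].
  have sub X : F X -> Q `|` X `<=` U.
    by move=> FX x [|Xx]; [left|right; exists X].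
  have addU x y : U x -> U y -> U (x + y).
    move=> /UE Ux /UE Uy.
    case: Ux => [Qx|[X FX Xx]]; case: Uy => [Qy|[Y FY Yy]].
    - by left; apply: coneD.
    - by apply: (sub Y) => //; apply: coneD => //; [exact: (FP Y FY).1.1|left].
    - by apply: (sub X) => //; apply: coneD => //; [exact: (FP X FX).1.1|left].
    - case: (Ftot X Y FX FY) => [XY|YX].
        apply: (sub Y) => //; apply: coneD => //; first exact: (FP Y FY).1.1.
        by case: Xx => [|/XY]; [left|right].
      apply: (sub X) => //; apply: coneD => //; first exact: (FP X FX).1.1.
      by case: Yy => [|/YX]; [left|right].
  split; last first.
    by case=> [|[X FX Xn]]; [exact: Qp|apply: (FP X FX).2; right].
  split; [split; [split|]|].
  - exact: addU.
  - move=> l x l0 /UE[Qx|[X FX Xx]]; first by left; apply: Qc.1.2.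
    by apply: (sub X) => //; apply: (FP X FX).1.1.1.2.
  - by left; apply: Qc.2.
  - move=> b x /UE[Qx|[X FX Xx]]; first by left; apply: Qm.2.
    by apply: (sub X) => //; apply: (FP X FX).1.2.
exists (Q `|` X); split=> // Q'' sQ'' Q''m Q''p.
have QE : Q `|` Q'' = Q''.
  by apply/seteqP; split=> x; [case=> // Qx; apply: sQ''; left|right].
apply: contrapT => nsub; apply: (Xmax Q''); last by rewrite /P QE.
split=> [x Xx|sub]; first by apply: sQ''; right.
by apply: nsub => x /sub; right.
Qed.

(** If neither [x] nor [-x] were in [Q], maximality would give [-1 = q1 + s1 x] and
    [-1 = q2 - s2 x]. Eliminating [x] puts [- s1] in [Q]. *)
Lemma maximal_qmodule_total : proper Q ->
  (forall Q', Q `<=` Q' -> qmodule Q' -> proper Q' -> Q' `<=` Q) ->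
  forall x, Q x \/ Q (- x).
Proof.
move=> Qp Qmax x.
have adj y : ~ Q y -> qmodule_adjoin Q y (- 1).
  move=> nQy; apply: contrapT => adjp; apply: nQy.
  apply: (Qmax _ (@sub_qmodule_adjoin y)) => //.
  - exact: qmodule_adjoin_qmodule.
  - exact: mem_qmodule_adjoin.
apply: contrapT => /not_orP[/adj[q1 [s1 [Qq1 Qs1 E1]]]].
move=> /adj[q2 [s2 [Qq2 Qs2 E2]]].
have Qs1N : Q (- s1).
  have -> : - s1 = s2 * q1 + s2 + s1 * q2 + s2 * (- 1 - (q1 + s1 * x))
              + s1 * (- 1 - (q2 + s2 * (- x))) by ring.
  rewrite -E1 -E2 !subrr !mulr0 !addr0.
  apply: coneD => //; last exact: Qs1.
  by apply: coneD => //; [apply: Qs2|apply: multiplier_mem].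
(* Now [s1] and [- s1] are both in [Q], hence so is [4 s1 x = (x + 1)^2 s1 - (x - 1)^2 s1]. *)
apply: Qp; apply: (cone_unscalen Qc (n := 3)).
have -> : 4 * (- 1 : A) = 4 * q1 + ((x + 1) ^+ 2 * s1 + (x - 1) ^+ 2 * (- s1)).
  by rewrite {1}E1; ring.
apply: coneD => //; first exact: coneMn.
by apply: coneD => //; apply: Qm.2 => //; apply: multiplier_mem.
Qed.

End OneQModule.

(** * The character of a total archimedean quadratic module *)

Section Characters.
Variables (Q : set A) (Qm : qmodule Q) (Qa : archimedean Q) (Qp : proper Q).
Let Qc : is_unital_cone Q := Qm.1.

Lemma proper_lt0 k : k < 0 -> ~ Q k%:K.
Proof.
move=> k0 Qk; apply: Qp; apply: (@cone_unscale _ _ _ Qc (- k)); first lra.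
by have -> : (- k)%:K * (- 1) = k%:K :> A by ring.
Qed.

(** In the order of [Q], [x] differs from [t] by an infinitesimal; [t] will be the value of the
    character at [x]. *)
Definition near_scalar x t :=
  forall e, 0 < e -> Q (x + (e - t)%:K) /\ Q ((t + e)%:K - x).

Lemma near_scalar_uniq x t u : near_scalar x t -> near_scalar x u -> t = u.
Proof.
suff le_near t' u' : near_scalar x t' -> near_scalar x u' -> u' <= t'.
  by move=> xt xu; apply/le_anti/andP; split; apply: le_near.
move=> xt xu; rewrite leNgt; apply/negP => tu.
have e0 : 0 < (u' - t') / 4 by lra.
apply: (@proper_lt0 ((t' - u') / 2)); first lra.
have -> : ((t' - u') / 2)%:K =
    (x + ((u' - t') / 4 - u')%:K) + ((t' + (u' - t') / 4)%:K - x).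
  have -> : (t' - u') / 2 = ((u' - t') / 4 - u') + (t' + (u' - t') / 4) by field.
  ring.
by apply: coneD => //; [apply: (xu _ e0).1|apply: (xt _ e0).2].
Qed.

(** The scalar is the supremum of the reals below [x]. Since [sup E + e] is not below [x], totality
    puts it above. *)
Lemma near_scalar_ex x : (forall y, Q y \/ Q (- y)) ->
  exists t : R, near_scalar x t.
Proof.
move=> Qt; pose E := [set r : R | Q (x - r%:K)].
have Esup : has_sup E.
  split.
    have [k Qk] := Qa (- x); exists (- k); rewrite /E /=.
    by have -> : x - (- k)%:K = k%:K - - x by ring.
  have [k Qk] := Qa x; exists k => r Er; rewrite leNgt; apply/negP => kr.
  apply: (@proper_lt0 (k - r)); first lra.
  have -> : (k - r)%:K = (k%:K - x) + (x - r%:K) by ring.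
  exact: coneD.
exists (sup E) => e e0; split.
  have [r Er lt_r] := sup_adherent e0 Esup.
  have -> : x + (e - sup E)%:K = (x - r%:K) + (e + r - sup E)%:K by ring.
  by apply: coneD => //; apply: coneK => //; lra.
have [Ee|] := Qt (x - (sup E + e)%:K); last by rewrite opprB.
by have := sup_upper_bound Esup Ee; rewrite gerDl leNgt e0.
Qed.

Lemma near_scalarD x y t u :
  near_scalar x t -> near_scalar y u -> near_scalar (x + y) (t + u).
Proof.
move=> xt yu e e0; have e2 : 0 < e / 2 by lra.
have [xt1 xt2] := xt _ e2; have [yu1 yu2] := yu _ e2.
rewrite [e]splitr; split.
  have -> : x + y + (e / 2 + e / 2 - (t + u))%:K =
    (x + (e / 2 - t)%:K) + (y + (e / 2 - u)%:K) by ring.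
  exact: coneD.
have -> : (t + u + (e / 2 + e / 2))%:K - (x + y) =
  ((t + e / 2)%:K - x) + ((u + e / 2)%:K - y) by ring.
exact: coneD.
Qed.

Lemma near_scalarK k : near_scalar k%:K k.
Proof.
move=> e e0; split.
  have -> : k%:K + (e - k)%:K = e%:K :> A by ring.
  by apply: coneK => //; lra.
have -> : (k + e)%:K - k%:K = e%:K :> A by ring.
by apply: coneK => //; lra.
Qed.

Lemma near_scalarN x t : near_scalar x t -> near_scalar (- x) (- t).
Proof.
move=> xt e e0; have [xt1 xt2] := xt _ e0; split.
  by have -> : - x + (e - - t)%:K = (t + e)%:K - x by ring.
by have -> : (- t + e)%:K - - x = x + (e - t)%:K by ring.
Qed.

Lemma near_scalarZ k x t : near_scalar x t -> near_scalar (k%:K * x) (k * t).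
Proof.
wlog k0 : k / 0 < k => [IH xt|].
  have [k0|k0|<-] := ltgtP 0 k; first exact: IH.
    have -> : k%:K * x = - ((- k)%:K * x) by ring.
    have -> : k * t = - (- k * t) by ring.
    by apply: near_scalarN; apply: IH => //; lra.
  by have := near_scalarK 0; rewrite rmorph0 !mul0r.
move=> xt e e0; have ke0 : 0 < k^-1 * e by rewrite mulr_gt0 ?invr_gt0.
have [xt1 xt2] := xt _ ke0.
split.
  have -> : k%:K * x + (e - k * t)%:K = k%:K * (x + (k^-1 * e - t)%:K).
    by rewrite mulrDr -rmorphM mulrBr mulVKf ?gt_eqF.
  by apply: coneZ => //; apply: ltW.
have -> : (k * t + e)%:K - k%:K * x = k%:K * ((t + k^-1 * e)%:K - x).
  by rewrite mulrBr -rmorphM mulrDr mulVKf ?gt_eqF.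
by apply: coneZ => //; apply: ltW.
Qed.

(** [Q] need not be closed under products, so [d^2 - x^2] is reached through [2d (d^2 - x^2) = (d -
    x)^2 (d + x) + (d + x)^2 (d - x)], which multiplies by squares only. *)
Lemma near_scalar_sq0 x : near_scalar x 0 -> near_scalar (x ^+ 2) 0.
Proof.
move=> x0 e e0; rewrite subr0 add0r; split.
  apply: coneD => //; last by apply: coneK => //; apply: ltW.
  by rewrite -[_ ^+ 2]mulr1; apply: Qm.2; apply: Qc.2.
(* The minimum with 1 ensures [d^2 <= e]. *)
pose d := Num.min 1 e.
have d0 : 0 < d by rewrite lt_min ltr01.
have d2 : 0 < 2 * d by lra.
have de : d * d <= e.
  apply: (@le_trans _ _ (1 * d)); last by rewrite mul1r ge_min lexx orbT.
  by rewrite ler_pM2r // ge_min lexx.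
have [xd1 xd2] := x0 _ d0; move: xd1 xd2; rewrite subr0 add0r => xd1 xd2.
have -> : e%:K - x ^+ 2 = (e - d * d)%:K + (d%:K ^+ 2 - x ^+ 2) by ring.
apply: coneD => //; first by apply: coneK => //; lra.
apply: (cone_unscale Qc d2).
have -> : (2 * d)%:K * (d%:K ^+ 2 - x ^+ 2) =
  (d%:K - x) ^+ 2 * (x + d%:K) + (x + d%:K) ^+ 2 * (d%:K - x) by ring.
by apply: coneD => //; apply: Qm.2.
Qed.

Lemma near_scalar_sq x t : near_scalar x t -> near_scalar (x ^+ 2) (t ^+ 2).
Proof.
move=> xt; have y0 : near_scalar (x + (- t)%:K) 0.
  by rewrite -(subrr t); apply: near_scalarD => //; apply: near_scalarK.
have -> : t ^+ 2 = 0 + (2 * t * t + - t ^+ 2) by ring.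
have -> : x ^+ 2 = (x + (- t)%:K) ^+ 2 + ((2 * t)%:K * x + (- t ^+ 2)%:K).
  by ring.
apply: near_scalarD; first exact: near_scalar_sq0.
by apply: near_scalarD; [apply: near_scalarZ|apply: near_scalarK].
Qed.

(** Polarization reduces products to squares. *)
Lemma near_scalarM x y t u :
  near_scalar x t -> near_scalar y u -> near_scalar (x * y) (t * u).
Proof.
move=> xt yu.
have -> : t * u = 4^-1 * ((t + u) ^+ 2 + - (t + - u) ^+ 2) by field.
have -> : x * y = (4^-1)%:K * ((x + y) ^+ 2 + - (x + - y) ^+ 2).
  have {1}-> : x * y = (4^-1 * 4)%:K * (x * y).
    by rewrite mulVf ?pnatr_eq0 // rmorph1 mul1r.
  ring.
apply: near_scalarZ; apply: near_scalarD; last apply: near_scalarN.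
  by apply: near_scalar_sq; apply: near_scalarD.
by apply: near_scalar_sq; apply: near_scalarD => //; apply: near_scalarN.
Qed.

Lemma near_scalar_ge0 x t : Q x -> near_scalar x t -> 0 <= t.
Proof.
move=> Qx xt; rewrite leNgt; apply/negP => t0.
have e0 : 0 < - t / 2 by lra.
have [_ xt2] := xt _ e0.
apply: (@proper_lt0 (t + - t / 2)); first lra.
by rewrite -[_%:K](subrK x); apply: coneD.
Qed.

Lemma total_qmodule_character : (forall x, Q x \/ Q (- x)) ->
  exists alpha : character A, forall x, Q x -> 0 <= alpha x.
Proof.
move=> Qt; pose f x := projT1 (cid (near_scalar_ex x Qt)).
have fP x : near_scalar x (f x) by rewrite /f; case: cid.
have fE x t : near_scalar x t -> f x = t by apply: near_scalar_uniq.
have f_lin : GRing.linear_for *%R f.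
  move=> k x y; apply: fE; apply: near_scalarD => //.
  by rewrite -mulr_algl; apply: near_scalarZ.
have f_mon : GRing.monoid_morphism f.
  split=> [|x y]; apply: fE; last exact: near_scalarM.
  by rewrite -(rmorph1 (GRing.in_alg A)); apply: near_scalarK.
pose fL := GRing.isLinear.Build R A R *%R f f_lin.
pose fM := GRing.isMonoidMorphism.Build A R f f_mon.
pose alpha : character A := HB.pack f fL fM.
by exists alpha => x Qx; apply: near_scalar_ge0 (fP x).
Qed.

End Characters.

Lemma archimedean_positivstellensatz Q c : qmodule Q -> archimedean Q ->
  (forall alpha : character A,
     (forall x, Q x -> 0 <= alpha x) -> 0 < alpha c) ->
  exists2 e : R, 0 < e & Q (c - e%:K).
Proof.
move=> Qm Qa c_gt0; apply: contrapT => nQ.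
have Qp : proper (qmodule_adjoin Q (- c)).
  by apply: proper_adjoin_opp => // e e0 Qce; apply: nQ; exists e.
have [Q' [sQ' Q'm Q'p Q'max]] :=
  exists_maximal_qmodule (qmodule_adjoin_qmodule Qm (- c)) Qp.
have sQQ' : Q `<=` Q' := subset_trans (@sub_qmodule_adjoin _ Qm (- c)) sQ'.
have [alpha alpha_ge0] := total_qmodule_character Q'm
  (sub_archimedean sQQ' Qa) Q'p (maximal_qmodule_total Q'm Q'p Q'max).
have := c_gt0 alpha (fun x Qx => alpha_ge0 x (sQQ' x Qx)).
have := alpha_ge0 _ (sQ' _ (mem_qmodule_adjoin Qm (- c))).
by rewrite raddfN oppr_ge0 leNgt => /negP.
Qed.

End QuadraticModules.

(** * The cone generated by the box products *)

Section BoxCone.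
Variables (R : realType) (A : comAlgType R) (T : A -> R).
Hypothesis T_gt0 : forall a, 0 < T a.
Implicit Types (a b : A).

Let C := unital_cone_gen (box_products T).
Let C_cone : is_unital_cone C := unital_cone_gen_unital _.
Let Cl := cone_closure C.
Let Cl_cone : is_unital_cone Cl := cone_closure_unital C_cone.

(** With [a] fixed, a product of two generators is again a generator; for generators with different
    [a] this can fail. *)
Definition line_products a : set A :=
  [set x | exists j k : nat, x = ((T a)%:A - a) ^+ j * ((T a)%:A + a) ^+ k].

Let P a := unital_cone_gen (line_products a).
Let P_cone a : is_unital_cone (P a) := unital_cone_gen_unital _.

Lemma line_cone_sub a : P a `<=` C.
Proof.
apply: smallest_sub => // x [j [k ->]].
by apply: sub_gen_smallest; exists a, j, k.
Qed.

Lemma line_cone_mul a : closed_under_mul (P a).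
Proof.
have PZ l x : 0 <= l -> P a x -> P a (l *: x) by apply: (P_cone a).1.2.
(* Two rounds of minimality: a generator times an element of the cone, then two elements of the
   cone. *)
have gen_mul g x : line_products a g -> P a x -> P a (g * x).
  move=> [j [k gE]]; move: x.
  apply: (@smallest_sub _ _ _ [set y | P a (g * y)]).
    split; [split=> [y z Py Pz|l y l0 Py]|] => /=.
    - by rewrite mulrDr; apply: (coneD (P_cone a)).
    - by rewrite -scalerAr; apply: PZ.
    - by rewrite mulr1; apply: sub_gen_smallest; exists j, k.
  move=> _ [j' [k' ->]]; apply: sub_gen_smallest; exists (j + j')%N, (k + k')%N.
  by rewrite gE !exprD mulrACA.
move=> x y Px Py; move: x Px.
apply: (@smallest_sub _ _ _ [set z | P a (z * y)]).
  split; [split=> [w z Pw Pz|l w l0 Pw]|] => /=.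
  - by rewrite mulrDl; apply: (coneD (P_cone a)).
  - by rewrite -scalerAl; apply: PZ.
  - by rewrite mul1r.
by move=> g ga; apply: gen_mul.
Qed.

Lemma line_coneB a : P a ((T a)%:K - a).
Proof. by apply: sub_gen_smallest; exists 1%N, 0%N; rewrite mulr1. Qed.

Lemma line_coneD a : P a ((T a)%:K + a).
Proof. by apply: sub_gen_smallest; exists 0%N, 1%N; rewrite mul1r. Qed.

Lemma sq_mem_closure b : Cl (b ^+ 2).
Proof.
move=> e e0; apply: (@line_cone_sub b).
exact: (sq_add_pos_mem (P_cone b) (@line_cone_mul b) (T_gt0 b)
  (@line_coneB b) (@line_coneD b)).
Qed.

(* With [z = k (q^2 + r)] and [r] small, [b^2 r] is bounded below by AM-GM:
   [2 d b^2 r = (d b^2 + r)^2 - d^2 b^4 - r^2], where [b^4] is bounded by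
   [T (b^2)^2] and [r^2] by [d^2]. *)
Lemma sq_mul_mem_closure a b z k : 0 < k -> P a z -> P a (k%:K - z) ->
  Cl (b ^+ 2 * z).
Proof.
move=> k0 Pz Pkz; have kV0 : 0 < k^-1 by rewrite invr_gt0.
pose y := (k^-1)%:K * z.
have zE : z = k%:K * y by rewrite mulrA -rmorphM divff ?gt_eqF // rmorph1 mul1r.
have Py : P a y by apply: (coneZ (P_cone a)) => //; apply: ltW.
have P1y : P a (1 - y).
  apply: (cone_unscale (P_cone a) k0).
  by rewrite mulrBr mulr1 -zE.
suff Cly : Cl (b ^+ 2 * y).
  have -> : b ^+ 2 * z = k%:K * (b ^+ 2 * y) by rewrite zE; ring.
  by apply: (coneZ Cl_cone) => //; apply: ltW.
apply: cone_closure_idem => // e e0.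
(* Bounding [b^4] by [S^2] and [r^2] by [d^2] costs [d^2 S^2 + d^2 = d^2 w], which this [d] makes
   equal to the available [2 d e]. *)
pose S := T (b ^+ 2); pose w := S ^+ 2 + 1.
have w0 : 0 < w by rewrite /w; have := sqr_ge0 S; lra.
pose d := 2 * e / w.
have d0 : 0 < d by rewrite /d divr_gt0 // mulr_gt0.
have dw : d * w = 2 * e by rewrite /d divfK // gt_eqF.
have [q [r [yE Pr Pdr]]] :=
  approx_sqrt (P_cone a) (@line_cone_mul a) Py P1y d0.
have d20 : 0 < 2 * d by lra.
apply: (cone_unscale Cl_cone d20).
have -> : (2 * d)%:K * (b ^+ 2 * y + e%:K) =
    (2 * d)%:K * (b * q) ^+ 2 + (d%:K * b ^+ 2 + r) ^+ 2
    + ((d ^+ 2)%:K * ((S%:K - b ^+ 2) * (S%:K + b ^+ 2))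
       + (d%:K - r) * (d%:K + r)) + (d * (2 * e - d * w))%:K.
  by rewrite yE /w; ring.
rewrite dw subrr mulr0 rmorph0 addr0.
apply: (coneD Cl_cone); apply: (coneD Cl_cone).
- by apply: (coneZ Cl_cone); [lra|apply: sq_mem_closure].
- exact: sq_mem_closure.
- apply: (coneZ Cl_cone); first exact: sqr_ge0.
  apply: (sub_cone_closure C_cone).
  by apply: (@line_cone_sub (b ^+ 2)); apply: line_cone_mul;
    [apply: line_coneB|apply: line_coneD].
- apply: (sub_cone_closure C_cone); apply: (@line_cone_sub a).
  apply: line_cone_mul => //; apply: (coneD (P_cone a)) => //.
  by apply: (coneK (P_cone a)) => //; apply: ltW.
Qed.

(** The largest quadratic module inside [Cl]; [b = 1] shows that it lies in [Cl]. *)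
Definition box_qmodule : set A := [set x | forall b, Cl (b ^+ 2 * x)].

Lemma box_qmodule_qmodule : qmodule box_qmodule.
Proof.
split; [split; [split=> [x y Mx My|l x l0 Mx]|]|] => b.
- by rewrite mulrDr; apply: (coneD Cl_cone).
- by rewrite -scalerAr; apply: Cl_cone.1.2.
- by rewrite mulr1; apply: sq_mem_closure.
- by move=> x Mx b'; rewrite mulrA -exprMn.
Qed.

(** The two factors [T a - a] and [T a + a] add up to [2 * T a], so each witnesses the upper bound
    of the other. *)
Lemma box_qmoduleB a : box_qmodule ((T a)%:K - a).
Proof.
move=> b; have T0 := T_gt0 a; apply: (@sq_mul_mem_closure a b _ (2 * T a)).
- by lra.
- exact: line_coneB.
- have -> : (2 * T a)%:K - ((T a)%:K - a) = (T a)%:K + a by ring.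
  exact: line_coneD.
Qed.

Lemma box_qmoduleD a : box_qmodule ((T a)%:K + a).
Proof.
move=> b; have T0 := T_gt0 a; apply: (@sq_mul_mem_closure a b _ (2 * T a)).
- by lra.
- exact: line_coneD.
- have -> : (2 * T a)%:K - ((T a)%:K + a) = (T a)%:K - a by ring.
  exact: line_coneB.
Qed.

(** The closure is removed here: [c - e] lies in [Cl], and the perturbation [e] allowed by [Cl]
    restores [c] in [C] itself. *)
Lemma box_qmodule_interior c e : 0 < e -> box_qmodule (c - e%:K) -> C c.
Proof.
by move=> e0 /(_ 1); rewrite expr1n mul1r => /(_ _ e0); rewrite subrK.
Qed.

End BoxCone.

Theorem proposition4p1 (R : realType) (A : comAlgType R)
    (XA_neq0 : character_space A !=set0)
    (T : A -> R) (T_gt0 : forall a : A, 0 < T a)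
    (c : A)
    (c_gt0 : forall alpha : character A,
       bounded_characters T alpha -> 0 < alpha c) :
  unital_cone_gen (box_products T) c.
Proof.
have [||alpha alpha_ge0|e e0] :=
  @archimedean_positivstellensatz R A (box_qmodule T) c.
- exact: box_qmodule_qmodule.
- by move=> a; exists (T a); apply: box_qmoduleB.
(* Nonnegativity of [alpha] at [T a - a] and [T a + a] amounts to membership in [K]. *)
- apply: c_gt0 => a; rewrite ler_norml.
  have alphaK k : alpha k%:K = k by rewrite linearZ /= rmorph1 mulr1.
  have aD : alpha ((T a)%:K + a) = T a + alpha a.
    by rewrite rmorphD; congr (_ + _); apply: alphaK.
  have aB : alpha ((T a)%:K - a) = T a - alpha a.
    by rewrite rmorphB; congr (_ - _); apply: alphaK.
  have := alpha_ge0 _ (box_qmoduleD T_gt0 a).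
  have := alpha_ge0 _ (box_qmoduleB T_gt0 a).
  by rewrite aD aB; lra.
- exact: box_qmodule_interior.
Qed.
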